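(* Let $E$ be an $\mathbb{R}$-group, $X$ a locally compact (Hausdorff) space not reduced to one point in which every point has a countable base of neighbourhoods, and $\mathcal{H}=(H_\varepsilon)_{\varepsilon\in E}$ a continuous absorptive action of $E$ on $X$ with center $\omega$. Then for every nonconstant continuous group homomorphism $h:E\to\mathbb{R}_+^*$ such that, for every $\alpha\in E$, the set $\{\varepsilon\in E:\varepsilon\ge\alpha\}$ is integrable for $h\cdot m$ ($m$ a Haar measure on $E$), there exists a nontrivial positive Radon measure $\lambda$ on $X$ with $H_\varepsilon(\lambda)=h(\varepsilon^{-1})\lambda$ for all $\varepsilon\in E$. In particular a nontrivial $\mathcal{H}$-homogeneous positive Radon measure on $X$ always exists.
   Context: An $\mathbb{R}$-group is an abelian group $E$ (operation written multiplicatively) whose underlying set is a subset of $\mathbb{R}$ containing all positive integers, such that: (RG1) with the natural order of $\mathbb{R}$, $E$ is a totally ordered group; (RG2) with the topology induced from $\mathbb{R}$, $E$ is a locally compact group; (RG3) there is at least one nonconstant continuous homomorphism $h:E\to\mathbb{R}_+^*$ such that for every $\alpha\in E$ the set $\{\varepsilon\in E:\varepsilon\ge\alpha\}$ is integrable for $h\cdot m$, $m$ a Haar measure on $E$. $e$ is the identity of $E$, $\varepsilon^{-1}$ the group inverse; inequalities refer to the order of $\mathbb{R}$. An action of $E$ on $X$ is a family $(H_\varepsilon)_{\varepsilon\in E}$ of bijections of $X$ with $H_\varepsilon\circ H_{\varepsilon'}=H_{\varepsilon\varepsilon'}$, $H_e=\mathrm{id}_X$; continuous if $(\varepsilon,x)\mapsto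 H_\varepsilon(x)$ is continuous on $E\times X$; absorptive if some $\omega\in X$ satisfies: for every neighbourhood $V$ of $\omega$ and every $x\in X$ there are a neighbourhood $U$ of $x$ and $\alpha\in E$ with $H_{\varepsilon^{-1}}(U)\subset V$ for all $\varepsilon\le\alpha$; this $\omega$ is unique and called the center. $H_\varepsilon(\lambda)$ is the image measure $\varphi\mapsto\int\varphi(H_\varepsilon(x))\,d\lambda(x)$, $\varphi\in\mathcal{K}(X)$. A positive Radon measure $\lambda$ is $\mathcal{H}$-homogeneous if for each $\varepsilon$ there is $c(\varepsilon)>0$ with $H_\varepsilon(\lambda)=c(\varepsilon)\lambda$. A Radon measure is nontrivial if it is different from $0$ and from $\delta_\omega$. *)

(* Defs.v *)
From HB Require Import structures.
From mathcomp Require Import all_boot all_order all_algebra.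
From mathcomp Require Import all_classical all_reals all_analysis.
Set Implicit Arguments. Unset Strict Implicit. Unset Printing Implicit Defensive.
Import Order.TTheory GRing.Theory Num.Theory.
Import numFieldNormedType.Exports.
Local Open Scope classical_set_scope.
Local Open Scope ring_scope.

Section Defs.
Context {R : realType}.

(* An R-group is given by its carrier E (a subset of R), its multiplication
   [mul], identity [e] and inverse [inv] (functions on R, only relevant on E). *)

Definition abelian_group_on (E : set R) (mul : R -> R -> R) (e : R)
  (inv : R -> R) : Prop :=
  (forall a b, E a -> E b -> E (mul a b)) /\
  E e /\ (forall a, E a -> E (inv a)) /\
  (forall a b c, E a -> E b -> E c -> mul a (mul b c) = mul (mul a b) c) /\
  (forall a b, E a -> E b -> mul a b = mul b a) /\
  (forall a, E a -> mul e a = a) /\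
  (forall a, E a -> mul (inv a) a = e).

Definition pos_hom (E : set R) (mul : R -> R -> R) (h : R -> R) : Prop :=
  [/\ forall a, E a -> 0 < h a,
      forall a b, E a -> E b -> h (mul a b) = h a * h b &
      {within E, continuous h}].

Definition nonconstant_on (E : set R) (h : R -> R) : Prop :=
  exists a b, [/\ E a, E b & h a <> h b].

(* Haar measure on E, seen as a (Borel) measure on R living on subsets of E:
   nonzero, finite on compact subsets of E, invariant under translations. *)
Definition haar_measure (E : set R) (mul : R -> R -> R)
  (m : {measure set R -> \bar R}) : Prop :=
  [/\ exists A, [/\ measurable A, A `<=` E & m A <> 0%E],
      forall K, compact K -> K `<=` E -> (m K < +oo)%E &
      forall a A, E a -> measurable A -> A `<=` E ->
        measurable (mul a @` A) -> m (mul a @` A) = m A].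

Definition upper_sets_integrable (E : set R) (h : R -> R)
  (m : {measure set R -> \bar R}) : Prop :=
  forall alpha, E alpha ->
    m.-integrable [set x | E x /\ alpha <= x] (fun x => (h x)%:E).

Definition is_R_group (E : set R) (mul : R -> R -> R) (e : R)
  (inv : R -> R) : Prop :=
  [/\ abelian_group_on E mul e inv,
      (forall n : nat, E n.+1%:R),
      (forall a b c, E a -> E b -> E c -> a <= b -> mul a c <= mul b c),
      [/\ {within E `*` E, continuous (fun p : R * R => mul p.1 p.2)},
          {within E, continuous inv} &
          @locally_compact (subspace E) [set: subspace E]] &
      exists h, [/\ pos_hom E mul h, nonconstant_on E h &
        exists m, haar_measure E mul m /\ upper_sets_integrable E h m]].

End Defs.

Definition first_countable (X : topologicalType) : Prop :=
  forall x : X, exists B : nat -> set X,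
    (forall n, nbhs x (B n)) /\ (forall V, nbhs x V -> exists n, B n `<=` V).

Definition is_action {R : realType} (X : Type) (E : set R)
  (mul : R -> R -> R) (e : R) (H : R -> X -> X) : Prop :=
  [/\ forall a, E a -> bijective (H a),
      forall a b, E a -> E b -> H a \o H b = H (mul a b) &
      H e = id].

Definition continuous_action {R : realType} (X : topologicalType) (E : set R)
  (H : R -> X -> X) : Prop :=
  {within E `*` [set: X], continuous (fun p : R * X => H p.1 p.2)}.

Definition absorptive_with_center {R : realType} (X : topologicalType)
  (E : set R) (inv : R -> R) (H : R -> X -> X) (omega : X) : Prop :=
  forall V, nbhs omega V -> forall x : X,
    exists U, exists2 alpha, E alpha /\ nbhs x U &
      forall eps, E eps -> eps <= alpha -> H (inv eps) @` U `<=` V.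

Definition Kc {R : realType} (X : topologicalType) (phi : X -> R) : Prop :=
  continuous phi /\ exists K, compact K /\ forall x, ~ K x -> phi x = 0.

Definition positive_radon {R : realType} (X : topologicalType)
  (lam : (X -> R) -> R) : Prop :=
  (forall (a : R) phi psi, Kc phi -> Kc psi ->
     lam (fun x => a * phi x + psi x) = a * lam phi + lam psi) /\
  (forall phi, Kc phi -> (forall x, 0 <= phi x) -> 0 <= lam phi).

Definition nontrivial_radon {R : realType} (X : topologicalType) (omega : X)
  (lam : (X -> R) -> R) : Prop :=
  (exists phi, Kc phi /\ lam phi <> 0) /\
  (exists phi, Kc phi /\ lam phi <> phi omega).

Definition image_measure {R : realType} (X : topologicalType)
  (f : X -> X) (lam : (X -> R) -> R) : (X -> R) -> R :=
  fun phi => lam (phi \o f).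

Definition homogeneous {R : realType} (X : topologicalType) (E : set R)
  (H : R -> X -> X) (lam : (X -> R) -> R) : Prop :=
  forall eps, E eps -> exists2 c : R, 0 < c &
    forall phi, Kc phi -> image_measure (H eps) lam phi = c * lam phi.

(* Main.v *)
(* Fix x0 <> omega and let lam be the image under eps |-> H_eps x0 of the
   measure h . m on E.  Absorption forces H_eps x0 to leave every compact set as
   eps becomes small, so the integrability of h . m on upper sets makes lam a
   Radon measure; Haar invariance of m turns H_a lam into h (a^-1) lam.  Open
   subsets of E are not m-null, hence lam <> 0, and lam <> delta_omega because
   the action fixes omega while h is not constant. *)
Require Import Defs.
From HB Require Import structures.
From mathcomp Require Import all_boot all_order all_algebra.
From mathcomp Require Import all_classical all_reals all_analysis.
From mathcomp Require Import measurable_realfun lra.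
Import Order.TTheory GRing.Theory Num.Theory.
Import numFieldNormedType.Exports.
Local Open Scope classical_set_scope.
Local Open Scope ring_scope.

(** * Rational covers of subsets of the line and Borel measurability of [E] *)

Lemma nbhs_rat_itv (R : realType) (x : R) (U : set R) : nbhs x U ->
  exists p q : rat, ratr p < x < ratr q /\ `]ratr p, ratr q[ `<=` U.
Proof.
move=> /nbhs_ballP[r /= r0 rU].
have /rat_in_itvoo[p /=] : x - r < x by rewrite ltrBlDr ltrDl.
rewrite in_itv /= => /andP[xp px].
have /rat_in_itvoo[q /=] : x < x + r by rewrite ltrDl.
rewrite in_itv /= => /andP[xq qx].
exists p, q; split; first by rewrite px xq.
move=> y /=; rewrite in_itv /= => /andP[py yq]; apply: rU.
by rewrite /ball /= ltr_norml; apply/andP; split; lra.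
Qed.

(** The rational intervals that fit inside some [V x] with [x] in [E] already cover [E], and
    [pickle] enumerates them. The other indices get the empty set, hence the nonemptiness guard in
    the second clause. *)
Lemma lindelof_real (R : realType) (E : set R) (V : R -> set R) :
  (forall x, E x -> nbhs x (V x)) ->
  exists I : nat -> set R,
    [/\ forall n, open (I n),
        forall n, I n !=set0 -> exists2 x, E x & I n `<=` V x &
        E `<=` \bigcup_n I n].
Proof.
move=> EV.
pose J n : set R := if @unpickle (rat * rat)%type n is Some pq
  then `]ratr pq.1, ratr pq.2[%classic else set0.
pose good n := exists2 x, E x & J n `<=` V x.
exists (fun n => if `[< good n >] then J n else set0); split.
- move=> n; case: ifPn => _; last exact: open0.
  by rewrite /J; case: unpickle => [pq|]; [exact: interval_open|exact: open0].
- by move=> n; case: ifPn => [/asboolP//|_ [y []]].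
- move=> x Ex; have [p [q [pxq pqV]]] := @nbhs_rat_itv _ _ _ (EV x Ex).
  exists (pickle (p, q)) => //.
  have -> : `[< good (pickle (p, q)) >].
    by apply/asboolP; exists x; [exact: Ex|rewrite /J pickleK].
  by rewrite /J pickleK /= in_itv.
Qed.

(** Near each of its points [E] agrees with a compact set, and by [lindelof_real] countably many
    such pieces exhaust it. *)
Lemma locally_compact_subspace_measurable (R : realType) (E : set R) :
  @locally_compact (subspace E) [set: subspace E] -> measurable E.
Proof.
move=> lcE.
have /choice[V VP] : forall x : R, exists W : set R,
    E x -> nbhs x W /\ measurable (E `&` W).
  move=> x; have [Ex|nEx] := pselect (E x); last by exists set0.
  have [U] := lcE x Logic.I; rewrite withinET => xU [cU _].
  have [W xW UW] := (@nbhs_subspace_ex R E U x Ex).1 xU.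
  exists W => _; split => //; rewrite setIC -UW.
  (* Points off [E] are isolated in [subspace E], so cutting [U] down to [E] keeps it compact, there
     and hence in the line. *)
  apply: compact_measurable; apply/compact_subspaceIP.
  apply: compact_closedI => //; exact: closed_subspaceT.
have [I [oI IV EI]] := lindelof_real _ _ _ (fun x Ex => (VP x Ex).1).
have -> : E = \bigcup_n (E `&` I n).
  by rewrite -setI_bigcupr; apply/seteqP; split => [x Ex|x []//]; split=> //; exact: EI.
apply: bigcup_measurable => n _.
have [/IV[x Ex IVx]|/set0P/negP/negPn/eqP ->] := pselect (I n !=set0); last first.
  by rewrite setI0.
rewrite -(setIidr IVx) setIA; apply: measurableI; first exact: (VP x Ex).2.
exact: open_measurable.
Qed.

(** * Sections of maps continuous on a product *)

Lemma within_setX_continuous_pairr (T1 T2 U : topologicalType) (A : set T1)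
    (B : set T2) (f : T1 * T2 -> U) (a : T1) : A a ->
  {within A `*` B, continuous f} -> {within B, continuous (fun y => f (a, y))}.
Proof.
move=> Aa /subspace_continuousP cf; apply/subspace_continuousP => y By.
apply: cvg_comp (cf (a, y) (conj Aa By)).
move=> W [[P Q] /= [aP yQ] PQ].
apply: filterS yQ => z Qz Bz; apply: (PQ (a, z)) => //.
by split => //; exact: nbhs_singleton aP.
Qed.

Lemma within_setX_continuous_pairl (T1 T2 U : topologicalType) (A : set T1)
    (B : set T2) (f : T1 * T2 -> U) (b : T2) : B b ->
  {within A `*` B, continuous f} -> {within A, continuous (fun x => f (x, b))}.
Proof.
move=> Bb /subspace_continuousP cf; apply/subspace_continuousP => x Ax.
apply: cvg_comp (cf (x, b) (conj Ax Bb)).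
move=> W [[P Q] /= [xP bQ] PQ].
apply: filterS xP => z Pz Az; apply: (PQ (z, b)) => //.
by split => //; exact: nbhs_singleton bQ.
Qed.

(** * Translations and Haar measure on [E] *)

Section Haar.
Context (R : realType) (E : set R) (mul : R -> R -> R) (e : R) (inv : R -> R).
Hypothesis groupE : abelian_group_on E mul e inv.
Hypothesis mul_continuous :
  {within E `*` E, continuous (fun p : R * R => mul p.1 p.2)}.
Hypothesis mE : measurable E.

Let mulE a b : E a -> E b -> E (mul a b). Proof. by case: groupE => + _; exact. Qed.
Let eE : E e. Proof. by case: groupE => _ []. Qed.
Let invE a : E a -> E (inv a). Proof. by case: groupE => _ [_ [+ _]]; exact. Qed.
Let mulA a b c : E a -> E b -> E c -> mul a (mul b c) = mul (mul a b) c.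
Proof. by case: groupE => _ [_ [_ [+ _]]]; exact. Qed.
Let mulC a b : E a -> E b -> mul a b = mul b a.
Proof. by case: groupE => _ [_ [_ [_ [+ _]]]]; exact. Qed.
Let mul1 a : E a -> mul e a = a.
Proof. by case: groupE => _ [_ [_ [_ [_ [+ _]]]]]; exact. Qed.
Let mulV a : E a -> mul (inv a) a = e.
Proof. by case: groupE => _ [_ [_ [_ [_ [_ ]]]]]; exact. Qed.

Lemma mul_invK a x : E a -> E x -> mul (inv a) (mul a x) = x.
Proof. by move=> Ea Ex; rewrite mulA ?mulV ?mul1//; exact: invE. Qed.

Lemma mul_Kinv a x : E a -> E x -> mul a (mul (inv a) x) = x.
Proof.
move=> Ea Ex; have Eia := invE _ Ea.
by rewrite mulA ?(mulC a) ?mulV ?mul1.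
Qed.

Lemma translation_continuous a : E a -> {within E, continuous (mul a)}.
Proof.
by move=> Ea; exact: (@within_setX_continuous_pairr _ _ _ _ _ _ _ Ea mul_continuous).
Qed.

(* The identity off E, so that the pushforward of m, a measure on all of R, makes
   sense. *)
Definition translation a x := if x \in E then mul a x else x.

Lemma translation_in a x : E x -> translation a x = mul a x.
Proof. by move=> Ex; rewrite /translation mem_set. Qed.

(** Pushforwards use preimages, whereas Haar invariance is about images; this passes between the
    two. As [A] lies in [E], the points fixed off [E] do not contribute. *)
Lemma preimage_translation a A : E a -> A `<=` E ->
  translation a @^-1` A = mul (inv a) @` A.
Proof.
move=> Ea AE; apply/seteqP; split => [x /=|x [y Ay <-]] /=.
  rewrite /translation; case: ifPn => [/set_mem Ex Aax|/negP + /AE /mem_set //].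
  by exists (mul a x) => //; rewrite mul_invK.
by rewrite translation_in ?mul_Kinv//; [exact: AE|apply: mulE; [exact: invE|exact: AE]].
Qed.

Lemma measurable_translation a : E a -> measurable_fun setT (translation a).
Proof.
move=> Ea _ B mB; rewrite setTI.
have -> : translation a @^-1` B = (E `&` mul a @^-1` B) `|` (~` E `&` B).
  apply/seteqP; split => x /=; rewrite /translation.
    by case: ifPn => [/set_mem|/negP nEx]; [left|right; split => // /mem_set].
  by case=> -[Ex Bx]; [rewrite mem_set|rewrite memNset].
apply: measurableU; last by apply: measurableI => //; exact: measurableC.
have : measurable_fun E (mul a).
  by apply: subspace_continuous_measurable_fun => //; exact: translation_continuous.
exact.
Qed.

Context (m : {measure set R -> \bar R}).
Hypothesis haar : haar_measure E mul m.

Lemma haar_preimage_translation a A : E a -> measurable A -> A `<=` E ->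
  m (translation a @^-1` A) = m A.
Proof.
move=> Ea mA AE; case: haar => _ _ minv.
rewrite preimage_translation // minv //; first exact: invE.
(* Invariance also asks that the translate be measurable: it is the preimage of [A] under a
   measurable map. *)
rewrite -preimage_translation // -[X in measurable X]setTI.
exact: measurable_translation.
Qed.

(** Change of variables along [translation a]: the pushforward of [m] agrees with [m] on measurable
    subsets of [E]. *)
Lemma haar_Rintegral_translation a (f : R -> R) : E a ->
  m.-integrable E (EFin \o f) -> m.-integrable E (EFin \o (f \o mul a)) ->
  \int[m]_(x in E) f (mul a x) = \int[m]_(x in E) f x.
Proof.
move=> Ea fint gint; congr fine.
have preE : translation a @^-1` E = E.
  rewrite preimage_translation //; apply/seteqP; split => [_ [x Ex <-]|x Ex].
    exact: mulE (invE _ Ea) Ex.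
  by exists (mul a x); [exact: mulE|rewrite mul_invK].
have eqg x : E x -> ((EFin \o f) \_ E \o translation a) x = (f (mul a x))%:E.
  by move=> Ex; rewrite /= translation_in // patchE mem_set//; exact: mulE.
(* Extending [f] by 0 off [E] gives an integrand that is measurable on the whole line. *)
transitivity (\int[pushforward m (translation a)]_(x in E) ((EFin \o f) \_ E) x)%E.
  have mt := measurable_translation _ Ea.
  rewrite (@integral_pushforward _ _ _ _ _ _ mt m E); last exact: mE.
  - by rewrite preE; apply: eq_integral => x /set_mem Ex; rewrite eqg.
  - have /(integrable_mkcond _ mE)/measurable_int := fint; exact.
  - rewrite preE; apply: eq_integrable gint => // x /set_mem Ex.
    by rewrite eqg.
transitivity (\int[m]_(x in E) ((EFin \o f) \_ E) x)%E.
  apply: eq_measure_integral => [|mt A mA AE]; first exact: measurable_translation.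
  exact: haar_preimage_translation.
by apply: eq_integral => x Ex; rewrite patchE Ex.
Qed.

(** If [W] were null, so would be its translates; countably many of them cover [E], so [m] would
    vanish on [E], against the nontriviality in [haar_measure]. *)
Lemma haar_nbhs_neq0 W : measurable W -> W `<=` E -> within E (nbhs e) W ->
  m W <> 0%E.
Proof.
move=> mW WE eW mW0.
(* Points off [E] belong to [V a] by default, so that [V a] is a neighbourhood of [a] in the line
   although [W] is one of [e] only relative to [E]. *)
pose V a := [set x | E x -> W (mul (inv a) x)].
have VP a : E a -> nbhs a (V a).
  move=> Ea; have cf : mul (inv a) x @[x --> within E (nbhs a)] --> e.
    rewrite -(mulV _ Ea).
    exact: (subspace_continuousP _ _).1 (translation_continuous _ (invE _ Ea)) _ Ea.
  have /cf aW : nbhs e [set x | E x -> W x] by [].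
  have {}aW : nbhs a [set x | E x -> E (mul (inv a) x) -> W (mul (inv a) x)] := aW.
  by apply: filterS aW => x + Ex; apply => //; exact: mulE (invE _ Ea) Ex.
have [I [oI IV EI]] := lindelof_real _ _ _ VP.
have nE : m.-negligible E.
  have -> : E = \bigcup_n (E `&` I n).
    by rewrite -setI_bigcupr; apply/seteqP; split => [x Ex|x []//]; split=> //; exact: EI.
  apply: negligible_bigcup => n.
  have [/IV[x Ex IVx]|/set0P/negP/negPn/eqP ->] := pselect (I n !=set0); last first.
    by rewrite setI0; exact: negligible_set0.
  (* Translation by [inv x] carries the part of [E] in [I n] into [W], so this part sits in a null
     preimage. *)
  exists (translation (inv x) @^-1` W); split.
  - by rewrite -[X in measurable X]setTI; apply: measurable_translation => //; exact: invE.
  - by rewrite haar_preimage_translation//; exact: invE.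
  - by move=> y [Ey Iy]; rewrite /= translation_in //; exact: IVx.
case: haar => -[A [mA AE mA0]] _ _; apply: mA0.
by apply/negligibleP => //; exact: negligibleS AE nE.
Qed.

End Haar.

(** * Compactly supported functions and absorption of compact sets *)

Lemma Kc_bounded (R : realType) (X : topologicalType) (phi : X -> R) :
  Kc phi -> exists C, forall x, `|phi x| <= C.
Proof.
move=> [cphi [K [cK K0]]].
have /compact_bounded[M [_ Mphi]] : compact (phi @` K).
  by apply: continuous_compact => //; exact: continuous_subspaceT.
exists (`|M| + 1) => x; have [Kx|nKx] := pselect (K x); last first.
  by rewrite K0 // normr0 addr_ge0.
apply: (Mphi (`|M| + 1)); last by exists x.
by rewrite (le_lt_trans (ler_norm M)) // ltrDl.
Qed.

Lemma Kc_comp (R : realType) (X : topologicalType) (f g : X -> X)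
    (phi : X -> R) :
  continuous f -> continuous g -> cancel f g -> Kc phi -> Kc (phi \o f).
Proof.
move=> cf cg fK [cphi [K [cK K0]]]; split.
  by move=> x; apply: continuous_comp; [exact: cf|exact: cphi].
(* This image is compact and contains the preimage of [K] under [f]. *)
exists (g @` K); split.
  by apply: continuous_compact => //; exact: continuous_subspaceT.
by move=> x nKx; apply: K0 => Kfx; apply: nKx; exists (f x).
Qed.

(** Complete regularity separates [x] from the complement of the interior of a compact
    neighbourhood; the separating function is 0 at [x] and 1 off that interior, so one minus it
    works. *)
Lemma Kc_positive_at (R : realType) (X : topologicalType) (x : X) :
  hausdorff_space X -> locally_compact [set: X] ->
  exists phi : X -> R, [/\ Kc phi, forall y, 0 <= phi y & 0 < phi x].
Proof.
move=> hX lX; have [K] := lX x Logic.I; rewrite withinET => xK [cK _].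
have : uniform_separator [set x] (~` K^°).
  apply: (@locally_compact_completely_regular X R lX hX).
    exact/open_closedC/open_interior.
  by rewrite /setC /=; apply; exact: xK.
move=> /(@uniform_separatorP X R)[f [cf f01 fx fK]].
exists (fun y => 1 - f y); split; last 2 first.
- move=> y; have := f01 (f y) (ex_intro2 _ _ y Logic.I erefl).
  by rewrite /= in_itv /= subr_ge0 => /andP[].
- by have -> : f x = 0 by apply: fx; exists x; rewrite // subr0.
split; first by move=> y; apply: cvgB; [exact: cvg_cst|exact: cf].
exists K; split => // y nKy.
have -> : f y = 1 by apply: fK; exists y => // /interior_subset.
by rewrite subrr.
Qed.

(** Absorption is local in the point; compactness of [K], in its near-covering form, makes the
    threshold uniform. The filter is generated by the half-lines [B alpha], nested because the order
    is total. *)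
Lemma absorb_compact (R : realType) (X : topologicalType) (E : set R)
    (inv : R -> R) (H : R -> X -> X) (omega : X) (K V : set X) :
  E !=set0 -> absorptive_with_center E inv H omega ->
  compact K -> nbhs omega V ->
  exists2 alpha, E alpha & forall eps, E eps -> eps <= alpha ->
    forall x, K x -> V (H (inv eps) x).
Proof.
move=> [a0 Ea0] absH /compact_near_coveringP cK nV.
pose B alpha := [set eps : R | eps <= alpha].
have Fil : Filter (filter_from E B).
  apply: filter_from_filter; first by exists a0.
  move=> a b Ea Eb; have [ab|/ltW ba] := leP a b.
    by exists a => // x /= xa; split => //; exact: le_trans ab.
  by exists b => // x /= xb; split => //; exact: le_trans ba.
have [x Kx|alpha Ealpha aK] :=
    cK R (filter_from E B) (fun eps x => E eps -> V (H (inv eps) x)) Fil.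
  have [U [alpha [Ealpha xU] UV]] := absH V nV x.
  exists (U, B alpha); first by split => //; exists alpha.
  by move=> [y eps] /= [Uy ea] Eeps; apply: (UV eps) => //; exists y.
by exists alpha => // eps Eeps ea x Kx; exact: (aK eps ea x Kx Eeps).
Qed.

(** * The action and its center *)

Section OrbitMeasure.
Context (R : realType) (E : set R) (mul : R -> R -> R) (e : R) (inv : R -> R)
  (X : topologicalType) (H : R -> X -> X) (omega : X).
Hypothesis groupE : abelian_group_on E mul e inv.
Hypothesis mul_continuous :
  {within E `*` E, continuous (fun p : R * R => mul p.1 p.2)}.
Hypothesis mE : measurable E.
Hypothesis hausdorffX : hausdorff_space X.
Hypothesis actionH : is_action E mul e H.
Hypothesis continuousH : continuous_action E H.
Hypothesis absorptiveH : absorptive_with_center E inv H omega.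

Let mulE a b : E a -> E b -> E (mul a b). Proof. by case: groupE => + _; exact. Qed.
Let eE : E e. Proof. by case: groupE => _ []. Qed.
Let invE a : E a -> E (inv a). Proof. by case: groupE => _ [_ [+ _]]; exact. Qed.
Let mulC a b : E a -> E b -> mul a b = mul b a.
Proof. by case: groupE => _ [_ [_ [_ [+ _]]]]; exact. Qed.
Let mulV a : E a -> mul (inv a) a = e.
Proof. by case: groupE => _ [_ [_ [_ [_ [_ ]]]]]; exact. Qed.

Lemma action_mul a b x : E a -> E b -> H a (H b x) = H (mul a b) x.
Proof. by move=> Ea Eb; case: actionH => _ /(_ _ _ Ea Eb) <-. Qed.

Lemma action_id x : H e x = x.
Proof. by case: actionH => _ _ ->. Qed.

Lemma action_invK a : E a -> cancel (H a) (H (inv a)).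
Proof.
by move=> Ea x; rewrite action_mul ?mulV ?action_id//; exact: invE.
Qed.

Lemma action_continuous a : E a -> continuous (H a).
Proof.
move=> Ea; apply/continuous_subspace_setT.
exact: (@within_setX_continuous_pairr _ _ _ _ _ _ _ Ea continuousH).
Qed.

Lemma orbit_continuous x : {within E, continuous (H ^~ x)}.
Proof.
exact: (@within_setX_continuous_pairl _ _ _ _ _ _ x Logic.I continuousH).
Qed.

(** As [d] decreases in [E], [H a (H (inv d) omega)] approaches [H a omega], by continuity and
    absorption at [omega]. Commuting the two maps gives [H (inv d) (H a omega)], which approaches
    [omega]; limits are unique in a Hausdorff space. *)
Lemma center_fixed a : E a -> H a omega = omega.
Proof.
move=> Ea; apply: hausdorffX => V W aV oW.
have nV : nbhs omega (H a @^-1` V) by exact: action_continuous aV.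
have [U1 [b [Eb oU1] bV]] := absorptiveH _ nV omega.
have [U2 [c [Ec aU2] cW]] := absorptiveH _ oW (H a omega).
have [d [Ed db dc]] : exists d, [/\ E d, d <= b & d <= c].
  by have [bc|/ltW cb] := leP b c; [exists b|exists c].
exists (H a (H (inv d) omega)); split.
  by apply: (bV d) => //; exists omega => //; exact: nbhs_singleton.
have Eid := invE _ Ed.
rewrite action_mul // (mulC a) // -action_mul //.
by apply: (cW d) => //; exists (H a omega) => //; exact: nbhs_singleton.
Qed.

(** * The image of [h . m] along the orbit of [x0] *)

Context (h : R -> R) (m : {measure set R -> \bar R}).
Hypothesis homh : pos_hom E mul h.
Hypothesis haarm : haar_measure E mul m.
Hypothesis integrableh : upper_sets_integrable E h m.

Let h_gt0 a : E a -> 0 < h a. Proof. by case: homh => + _ _; exact. Qed.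
Let hM a b : E a -> E b -> h (mul a b) = h a * h b.
Proof. by case: homh => _ + _; exact. Qed.

Lemma hom_id : h e = 1.
Proof.
have mul1 : mul e e = e by case: groupE => _ [_ [_ [_ [_ [+ _]]]]]; exact.
by apply: (mulfI (lt0r_neq0 (h_gt0 _ eE))); rewrite mulr1 -hM // mul1.
Qed.

Lemma hom_inv a : E a -> h (inv a) * h a = 1.
Proof. by move=> Ea; rewrite -hM ?mulV ?hom_id//; exact: invE. Qed.

Context (x0 : X).
Hypothesis x0_omega : x0 <> omega.

Definition orbit_density (phi : X -> R) eps := phi (H eps x0) * h eps.

Definition orbit_measure (phi : X -> R) := \int[m]_(eps in E) orbit_density phi eps.

Lemma orbit_density_continuous phi : continuous phi ->
  {within E, continuous (orbit_density phi)}.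
Proof.
move=> cphi eps; apply: (@continuousM _ (subspace E)); last by case: homh => _ _; exact.
by apply: continuous_comp; [exact: orbit_continuous|exact: cphi].
Qed.

(* x0 = H_(eps^-1) (H_eps x0): if H_eps x0 were in a compact set with eps small,
   absorption would put x0 in any given neighbourhood of omega. *)
Lemma orbit_density_small_eq0 phi : Kc phi ->
  exists2 alpha, E alpha &
    forall eps, E eps -> eps <= alpha -> orbit_density phi eps = 0.
Proof.
move=> [cphi [K [cK K0]]].
have nV : nbhs omega (~` [set x0]).
  apply: open_nbhs_nbhs; split; last by move=> /= ox; exact/x0_omega/esym.
  apply/closed_openC/accessible_closed_set1/hausdorff_accessible.
  exact: hausdorffX.
have [alpha Ealpha aK] := @absorb_compact _ _ _ _ _ _ K _ (ex_intro _ _ eE) absorptiveH cK nV.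
exists alpha => // eps Eeps ea; rewrite /orbit_density K0 ?mul0r// => KHx.
by apply: (aK _ Eeps ea _ KHx); rewrite action_invK.
Qed.

(** The density vanishes below some [alpha] and is bounded in absolute value by a multiple of [h]
    above it, where [h] is integrable. Linearity, homogeneity and nonvanishing of [orbit_measure]
    all rest on this. *)
Lemma orbit_density_integrable phi : Kc phi ->
  m.-integrable E (EFin \o orbit_density phi).
Proof.
move=> Kphi; have [alpha Ealpha small0] := orbit_density_small_eq0 _ Kphi.
have [C phiC] := Kc_bounded _ _ _ Kphi.
pose D := [set x | E x /\ alpha <= x].
have mD : measurable D.
  have -> : D = E `&` `[alpha, +oo[.
    by apply/seteqP; split => x [Ex]; rewrite /= in_itv /= andbT.
  exact: measurableI.
(* The dominating function is [C * h] on the upper set [D] and zero elsewhere, so that the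
   comparison runs over all of [E]. *)
have intD : m.-integrable E ((fun x => (C * h x)%:E) \_ D).
  apply: (@integrableS _ _ _ _ setT) => //.
  apply/(integrable_mkcond _ mD).
  apply: eq_integrable (integrableZl mD C (integrableh _ Ealpha)) => //.
apply: le_integrable intD => //.
  apply/measurable_EFinP; apply: subspace_continuous_measurable_fun => //.
  by apply: orbit_density_continuous; case: Kphi.
move=> x Ex; rewrite patchE; case: ifPn => [/set_mem [_ ax]|/negP nDx].
  rewrite /= lee_fin !normrM ler_wpM2r// (le_trans (phiC _))//.
  exact: ler_norm.
rewrite /= small0 ?normr0 ?abse_ge0//.
by apply: contrapT => /negP; rewrite -ltNge => /ltW ax; apply: nDx; rewrite inE.
Qed.

Lemma orbit_measure_radon : positive_radon orbit_measure.
Proof.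
split=> [a phi psi Kphi Kpsi|phi Kphi phi0]; last first.
  by apply: Rintegral_ge0 => x Ex; rewrite mulr_ge0// ltW// h_gt0.
have iphi := orbit_density_integrable _ Kphi.
have ipsi := orbit_density_integrable _ Kpsi.
rewrite /orbit_measure -RintegralZl // -RintegralD //.
  by apply: eq_Rintegral => x _; rewrite /orbit_density mulrDl mulrA.
exact: (integrableZl mE a iphi).
Qed.

(** The density of [phi] at [mul a eps] is [h a] times that of [phi \o H a] at [eps]. Haar
    invariance absorbs the translation, and [h (inv a)] cancels [h a]. *)
Lemma orbit_measure_homogeneous a phi : E a -> Kc phi ->
  orbit_measure (phi \o H a) = h (inv a) * orbit_measure phi.
Proof.
move=> Ea Kphi.
have Kphia : Kc (phi \o H a).
  apply: (Kc_comp _ _ _ (H (inv a))) => //; [exact: action_continuous| |exact: action_invK].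
  exact/action_continuous/invE.
have eqd x : E x -> orbit_density phi (mul a x) = h a * orbit_density (phi \o H a) x.
  by move=> Ex; rewrite /orbit_density hM // -action_mul //= mulrCA.
have iphi := orbit_density_integrable _ Kphi.
have iphia := orbit_density_integrable _ Kphia.
have <- : \int[m]_(x in E) orbit_density phi (mul a x) = orbit_measure phi.
  apply: (haar_Rintegral_translation _ _ _ _ _ groupE) => //.
  apply: eq_integrable (integrableZl mE (h a) iphia) => // x /set_mem Ex.
  by rewrite /= eqd.
have -> : \int[m]_(x in E) orbit_density phi (mul a x) =
    \int[m]_(x in E) (h a * orbit_density (phi \o H a) x).
  by apply: eq_Rintegral => x /set_mem; exact: eqd.
by rewrite RintegralZl // mulrA hom_inv // mul1r.
Qed.

(** * Nontriviality of the orbit measure *)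

(** The density is continuous with value [phi x0] at [e], hence positive on a neighbourhood [W] of
    [e] in [E]. A zero integral of a nonnegative density would make [W] null, against
    [haar_nbhs_neq0]. *)
Lemma orbit_measure_neq0 phi : Kc phi -> (forall x, 0 <= phi x) ->
  0 < phi x0 -> orbit_measure phi <> 0.
Proof.
move=> Kphi phi0 phix0 int0.
have cf : {within E, continuous (orbit_density phi)}.
  by apply: orbit_density_continuous; case: Kphi.
have mf : measurable_fun E (orbit_density phi).
  exact: subspace_continuous_measurable_fun.
pose W := E `&` orbit_density phi @^-1` [set y | 0 < y].
have oP : open [set y : R | 0 < y] by exact: open_gt.
have mW : measurable W by apply: mf => //; exact: open_measurable.
have iphi := orbit_density_integrable _ Kphi.
apply: (haar_nbhs_neq0 _ _ _ _ _ groupE mul_continuous mE _ haarm W mW); first by move=> x [].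
- have fe : 0 < orbit_density phi e.
    by rewrite /orbit_density action_id hom_id mulr1.
  have /((subspace_continuousP _ _).1 cf _ eE) eW :
      nbhs (orbit_density phi e) [set y | 0 < y] by exact: open_nbhs_nbhs.
  have {}eW : nbhs e [set x | E x -> 0 < orbit_density phi x] := eW.
  by apply: filterS eW => x fx Ex; split => //; exact: fx.
- have : ae_eq m E (EFin \o orbit_density phi) (cst 0%E).
    have mEf : measurable_fun E (EFin \o orbit_density phi) by exact/measurable_EFinP.
    apply: (ae_eq_integral_abs m mE mEf).1.
    (* [int0] concerns the [fine] of the integral, which is 0 at infinite values too; integrability
       excludes these. *)
    rewrite -[RHS]/(0%:E) -int0 /orbit_measure /Rintegral fineK; last first.
      exact: integrable_fin_num.
    by apply: eq_integral => x /set_mem Ex /=; rewrite ger0_norm// mulr_ge0// ltW// h_gt0.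
  move=> /negligibleS nW; apply/negligibleP => //; apply: nW => x [Ex fx] /= f0.
  by move: fx => /=; case: (f0 Ex) => ->; rewrite ltxx.
Qed.

Hypothesis locally_compactX : locally_compact [set: X].
Hypothesis nonconstanth : nonconstant_on E h.

Lemma orbit_measure_nontrivial : nontrivial_radon omega orbit_measure.
Proof.
have [phi [Kphi phi0 phix0]] := Kc_positive_at R X x0 hausdorffX locally_compactX.
have nz := orbit_measure_neq0 _ Kphi phi0 phix0.
split; first by exists phi.
(* delta_omega is invariant since the action fixes omega, whereas a nonzero
   orbit measure is multiplied by h (inv a) <> 1 for some a. *)
apply: contrapT => dirac.
have eq_dirac psi : Kc psi -> orbit_measure psi = psi omega.
  by move=> Kpsi; apply: contrapT => ne; apply: dirac; exists psi.
have h1 a : E a -> h a = 1.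
  move=> Ea; have Kphia : Kc (phi \o H a).
    apply: (Kc_comp _ _ _ (H (inv a))) => //; [exact: action_continuous| |exact: action_invK].
    exact/action_continuous/invE.
  (* Both [phi \o H a] and [phi] take the same value at [omega], so [inva] equates
     [orbit_measure phi] with [h (inv a)] times itself. *)
  have := orbit_measure_homogeneous _ _ Ea Kphi.
  rewrite eq_dirac //= center_fixed // -eq_dirac // => inva.
  have hia : h (inv a) = 1.
    by apply: (mulIf (introN eqP nz)); rewrite -inva mul1r.
  by have := hom_inv _ Ea; rewrite hia mul1r.
by case: nonconstanth => a [b [Ea Eb]]; apply; rewrite !h1.
Qed.

End OrbitMeasure.

(** * Existence of homogeneous measures *)

Theorem theorem3p1 (R : realType) (E : set R) (mul : R -> R -> R) (e : R)
  (inv : R -> R) (X : topologicalType) (H : R -> X -> X) (omega : X) :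
  is_R_group E mul e inv ->
  hausdorff_space X -> locally_compact [set: X] -> first_countable X ->
  (exists x y : X, x <> y) ->
  is_action E mul e H -> continuous_action E H ->
  absorptive_with_center E inv H omega ->
  (forall (h : R -> R) (m : {measure set R -> \bar R}),
     pos_hom E mul h -> nonconstant_on E h ->
     haar_measure E mul m -> upper_sets_integrable E h m ->
     exists lam : (X -> R) -> R,
       [/\ positive_radon lam, nontrivial_radon omega lam &
         forall eps, E eps -> forall phi, Kc phi ->
           image_measure (H eps) lam phi = h (inv eps) * lam phi])
  /\
  (exists lam : (X -> R) -> R,
     [/\ positive_radon lam, nontrivial_radon omega lam &
       homogeneous E H lam]).
Proof.
move=> [gE _ _ [cmul _ lcE] [h0 [homh0 nch0 [m0 [haar0 int0]]]]].
move=> hX lX _ [x [y xy]] actH contH absH.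
have mE := locally_compact_subspace_measurable _ _ lcE.
have [x0 x0_omega] : exists x0, x0 <> omega.
  have [xo|] := pselect (x = omega); last by exists x.
  by exists y => yo; apply: xy; rewrite xo yo.
have main h m : pos_hom E mul h -> nonconstant_on E h ->
    haar_measure E mul m -> upper_sets_integrable E h m ->
    exists lam : (X -> R) -> R,
      [/\ positive_radon lam, nontrivial_radon omega lam &
        forall eps, E eps -> forall phi, Kc phi ->
          image_measure (H eps) lam phi = h (inv eps) * lam phi].
  move=> homh nch haar inth; exists (orbit_measure R E X H h m x0); split.
  - by apply: orbit_measure_radon; eassumption.
  - by apply: orbit_measure_nontrivial; eassumption.
  - by move=> eps Eeps phi Kphi; apply: orbit_measure_homogeneous; eassumption.
split; first exact: main.
(* The pair [h0], [m0] comes from (RG3) in [is_R_group]; the homogeneity constant at [eps] is then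
   [h0 (inv eps)]. *)
have [lam [radon nontriv hom]] := main h0 m0 homh0 nch0 haar0 int0.
exists lam; split=> // eps Eeps; exists (h0 (inv eps)); last exact: hom.
by case: homh0 => + _ _; apply; case: gE => _ [_ [+ _]]; exact.
Qed.
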